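(* Let $K$ be a field, $S=K[x_1,\ldots,x_n]$, and let $I\subset S$ be a monomial ideal with $\dim S/I=0$. Let $\Delta(I)$ be the simplicial complex whose Stanley--Reisner ideal is the polarization $I^\wp$ of $I$. Then $\Delta(I)$ is shellable.
   Context: For a monomial ideal $I$, $G(I)$ is its unique minimal set of monomial generators. For $i=1,\ldots,n$ let $b_i\ge 1$ be the smallest integer with $x_i^{b_i}\in I$ (it exists since $\dim S/I=0$). $S^\wp$ is the polynomial ring over $K$ in the variables $x_{i,j}$, $1\le i\le n$, $1\le j\le b_i$. The polarization of a monomial $v=x_1^{c_1}\cdots x_n^{c_n}$ with $c_i\le b_i$ is $v^\wp=\prod_{i=1}^n\prod_{j=1}^{c_i}x_{i,j}$, and the polarization of $I$ is the ideal $I^\wp\subset S^\wp$ generated by the monomials $v^\wp$ with $v\in G(I)$. $\Delta(I)$ is the simplicial complex on the set $\mathcal{S}$ of variables of $S^\wp$ whose faces are the subsets $F\subset\mathcal{S}$ with $\prod_{x\in F}x\notin I^\wp$ (a variable need not itself be a face). A pure simplicial complex is shellable if its facets can be ordered $F_1,\ldots,F_m$ so that for all $1\le i<j\le m$ there exist $x\in F_j\setminus F_i$ and $k<j$ with $F_j\setminus F_k=\{x\}$. *)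

(* Defs.v *)
From HB Require Import structures.
From mathcomp Require Import all_boot all_order all_algebra.
From mathcomp Require Import ring_quotient.
From mathcomp Require Import boolp classical_sets.
From mathcomp Require Import mpoly.

Set Implicit Arguments.
Unset Strict Implicit.
Unset Printing Implicit Defensive.

Import GRing.Theory.
Local Open Scope ring_scope.
Local Open Scope classical_set_scope.

Definition prime_chain (R : comNzRingType) (d : nat) : Prop :=
  exists P : 'I_d.+1 -> PrimeIdealr.type R,
    forall i j : 'I_d.+1, (i < j)%N ->
      {subset P i <= P j} /\ ~ {subset P j <= P i}.

Definition has_krull_dim (R : comNzRingType) (d : nat) : Prop :=
  prime_chain R d /\ forall e, prime_chain R e -> (e <= d)%N.

Definition ideal_span (R : comNzRingType) (A : set R) : set R :=
  [set p | exists s : seq (R * R),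
     (forall x, x \in s -> A x.2) /\ p = \sum_(x <- s) x.1 * x.2].

Lemma ideal_spanMl (R : comNzRingType) (A : set R) (a p : R) :
  ideal_span A p -> ideal_span A (a * p).
Proof.
case=> s [sA ->]; exists [seq (a * x.1, x.2) | x <- s]; split.
  by move=> x /mapP[y ys ->]; exact: sA ys.
by rewrite mulr_sumr big_map; apply: eq_bigr => x _; rewrite mulrA.
Qed.

Lemma ideal_span_incl (R : comNzRingType) (A : set R) a : A a -> ideal_span A a.
Proof.
move=> Aa; exists [:: (1, a)]; split; last by rewrite big_seq1 mul1r.
by move=> x; rewrite inE => /eqP ->.
Qed.

Lemma ideal_span_idem (R : comNzRingType) (A B : set R) :
  A `<=` ideal_span B -> ideal_span A `<=` ideal_span B.
Proof.
move=> AB p [s [sA ->]].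
elim: s sA => [|x s IH] sA; first by exists [::]; split=> //; rewrite !big_nil.
rewrite big_cons.
have [|t [tB ->]] := IH; first by move=> y ys; apply: sA; rewrite inE ys orbT.
have [] := @ideal_spanMl _ B x.1 x.2 (AB _ (sA x (mem_head _ _))) => u [uB ->].
exists (u ++ t); split; last by rewrite big_cat.
by move=> y; rewrite mem_cat => /orP[/uB|/tB].
Qed.

Section MonomialIdeals.
Variables (K : fieldType) (n : nat).
Implicit Types (I : {pred {mpoly K[n]}}) (G : set 'X_{1..n}).

Definition generated_by I G : Prop :=
  [set` I] = ideal_span [set 'X_[m] | m in G].

Definition monomial_ideal I : Prop := exists G, generated_by I G.

Definition minimally_generated_by I G : Prop :=
  generated_by I G /\ forall H, generated_by I H -> H `<=` G -> H = G.

(* The unique minimal set of monomial generators ([mingensP] below); the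
   default [set0] is not used when I is a monomial ideal. *)
Definition mingens I : set 'X_{1..n} :=
  xget set0 [set G | minimally_generated_by I G].

Lemma ideal_span_monomial (A : set 'X_{1..n}) (m : 'X_{1..n}) :
  ideal_span [set 'X_[K, a] | a in A] 'X_[m] -> exists2 a, A a & (a <= m)%MM.
Proof.
case=> s [sA E].
have : m \in msupp (\sum_(x <- s) x.1 * x.2) by rewrite -E msuppX inE.
move/(@msupp_sum_le _ _ _ _ _ _ m); rewrite filter_predT.
case/flatten_mapP=> x xs; have [a Aa <-] := sA _ xs.
rewrite (perm_mem (msuppMX _ _)) => /mapP[w _ ->]; exists a => //.
exact: lem_addr.
Qed.

Lemma lem_antisym (a b : 'X_{1..n}) : (a <= b)%MM -> (b <= a)%MM -> a = b.
Proof.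
move=> /mnm_lepP ab /mnm_lepP ba; apply/mnmP => i.
by apply/eqP; rewrite eqn_leq ab ba.
Qed.

Lemma mingensP (I : {pred {mpoly K[n]}}) :
  monomial_ideal I ->
  minimally_generated_by I (mingens I) /\
  (forall G, minimally_generated_by I G -> G = mingens I).
Proof.
move=> [A gA].
have monoI G (gG : generated_by I G) m :
    'X_[m] \in I <-> exists2 a, G a & (a <= m)%MM.
  split=> [mI|[a Ga am]].
    by have : [set` I] 'X_[m]; [exact: mI|rewrite gG => /ideal_span_monomial].
  have : [set` I] 'X_[m]; last by [].
  rewrite gG -(submK am) mpolyXD; apply: ideal_spanMl; apply: ideal_span_incl.
  by exists a.
pose D := [set m | 'X_[m] \in I /\
  forall d, 'X_[d] \in I -> (d <= m)%MM -> d = m].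
have DG G : generated_by I G -> D `<=` G.
  move=> gG m [mI dm]; have [a Ga am] := (monoI _ gG m).1 mI.
  by rewrite -(dm a) //; apply/(monoI _ gG); exists a => //; exact: lepm_refl.
have below k : forall m, (mdeg m <= k)%N -> 'X_[m] \in I ->
    exists2 d, D d & (d <= m)%MM.
  elim: k => [|k IH] m mk mI.
    exists m; last exact: lepm_refl.
    split=> // d _ dm; apply: lem_antisym => //; apply/mnm_lepP => i.
    have /eqP : mdeg m = 0%N by apply/eqP; rewrite -leqn0.
    by rewrite mdeg_eq0 => /eqP ->; rewrite mnm0E.
  have [h|] := pselect (D m); first by exists m => //; exact: lepm_refl.
  move=> nD; have [d [dI dm dNm]] :
      exists d, [/\ 'X_[d] \in I, (d <= m)%MM & d <> m].
    apply: contrapT => H; apply: nD; split=> // d dI dm; apply: contrapT => ne.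
    by apply: H; exists d.
  have ltd : (mdeg d < mdeg m)%N.
    rewrite -(submK dm) mdegD -[X in (X < _)%N]add0n ltn_add2r lt0n mdeg_eq0.
    apply/eqP => E; apply: dNm; by rewrite -(submK dm) E add0m.
  have [|e De ed] := IH d _ dI; first by rewrite -ltnS; exact: leq_trans mk.
  exists e => //; exact: lepm_trans dm.
have gD : generated_by I D.
  rewrite /generated_by gA; apply/seteqP; split;
      apply: ideal_span_idem => _ [m Am <-].
    have [|d Dd dm] := below _ _ (leqnn (mdeg m)).
      by apply/(monoI _ gA); exists m => //; exact: lepm_refl.
    rewrite -(submK dm) mpolyXD; apply: ideal_spanMl; apply: ideal_span_incl.
    by exists d.
  by apply: ideal_span_incl; exists m => //; exact: DG Am.
have mD : minimally_generated_by I D.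
  by split=> // H gH HD; apply/seteqP; split=> //; exact: DG.
have uD G : minimally_generated_by I G -> G = D.
  by move=> [gG mG]; symmetry; apply: mG => //; exact: DG.
have mm : minimally_generated_by I (mingens I).
  by rewrite /mingens; case: xgetP => [//|/(_ D)].
by split=> // G /uD ->; symmetry; exact: uD.
Qed.

(* Junk value 0 when no positive power of x_i lies in I. *)
Definition var_exp I (i : 'I_n) : nat :=
  match pselect (exists k, (0 < k)%N && ('X_i ^+ k \in I)) with
  | left h => ex_minn h
  | right _ => 0%N
  end.

(* (i, j) stands for x_{i+1,j+1}: both indices start at 0. *)
Definition polvar I : finType := {i : 'I_n & 'I_(var_exp I i)}.

End MonomialIdeals.

(* The variable of K[T], for a finite type T of variables, is indexed by
   [enum_rank]. *)
Definition mvar (K : fieldType) (T : finType) (t : T) : {mpoly K[#|T|]} :=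
  'X_(enum_rank t).

Section Polarization.
Variables (K : fieldType) (n : nat) (I : {pred {mpoly K[n]}}).

(* For v in [mingens I], v_i <= var_exp I i, so no factor x_{i,j} with
   j <= v_i is lost. *)
Definition polmon (v : 'X_{1..n}) : {mpoly K[#|polvar I|]} :=
  \prod_(t : polvar I | (tagged t < v (tag t))%N) mvar K t.

Definition polarization : set {mpoly K[#|polvar I|]} :=
  ideal_span [set polmon v | v in mingens I].

End Polarization.

Arguments polarization {K n} I _.

(* Not every vertex is required to be a face. *)
Record simplicial_complex (V : finType) := SimplicialComplex {
  faces :> {set {set V}};
  facesS : forall F G : {set V}, F \in faces -> G \subset F -> G \in faces
}.

Section Shellable.
Variable V : finType.
Implicit Types D : simplicial_complex V.

Definition facet D (F : {set V}) : bool := maxset (mem (faces D)) F.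

Definition pure D : Prop :=
  forall F G : {set V}, facet D F -> facet D G -> #|F| = #|G|.

Definition shelling (s : seq {set V}) : Prop :=
  forall i j, (i < j < size s)%N ->
    let F k := nth finset.set0 s k in
    exists x, x \in F j :\: F i /\
      exists2 k, (k < j)%N & F j :\: F k = [set x]%SET.

Definition shellable D : Prop :=
  pure D /\
  exists s : seq {set V}, [/\ uniq s, s =i facet D & shelling s].

End Shellable.

Section StanleyReisner.
Variables (K : fieldType) (n : nat) (I : {pred {mpoly K[n]}}).

Definition Delta_faces : {set {set polvar I}} :=
  [set F : {set polvar I} |
     `[< ~ polarization I (\prod_(x in F) mvar K x) >]]%SET.

Lemma Delta_facesS (F G : {set polvar I}) :
  F \in Delta_faces -> G \subset F -> G \in Delta_faces.
Proof.
rewrite !inE => nF sGF iG; apply: nF.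
rewrite (big_setID G) /= (finset.setIidPr sGF) mulrC.
exact: ideal_spanMl.
Qed.

Definition Delta : simplicial_complex (polvar I) :=
  SimplicialComplex Delta_facesS.

End StanleyReisner.

(* Main.v *)
(** If no positive power of x_i lay in I, the kernels of the two evaluations
    S -> K[x], sending all the other variables to 0 and x_i to x, resp. to 0,
    would contain I and give a chain of two primes in S/I.  Hence every b_i is
    positive and x_i^{b_i} lies in I.

    Index the variables x_{i,j} from j = 0, and for a set F of variables let a_i
    be the least j with x_{i,j} not in F.  Then F is a face iff every a_i exists
    and x^a is not in I, so the facets are exactly the complements of
    {x_{i,a_i} : i} with x^a not in I.  Sort them by the degree of x^a.  If a
    comes before b, some b_t > a_t; replacing b_t by a_t in b yields a proper
    divisor x^c of x^b, hence an earlier facet, which misses only the variable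
    x_{t,a_t} of the facet of b. *)
Require Import Defs.
From HB Require Import structures.
From mathcomp Require Import boolp classical_sets.
From mathcomp Require Import all_boot all_order all_algebra.
From mathcomp Require Import generic_quotient ring_quotient.
From mathcomp Require Import mpoly.

Set Implicit Arguments.
Unset Strict Implicit.
Unset Printing Implicit Defensive.

Import GRing.Theory.

(** * Dimension zero forces powers of the variables into $I$ *)

Section ZeroDimensional.
Local Open Scope ring_scope.
Local Open Scope quotient_scope.

Lemma prime_ideal_quot_kernel (R : comNzRingType) (D : idomainType)
    (I : idealr R) (phi : {rmorphism R -> D}) :
  (forall x, x \in I -> phi x = 0) ->
  exists P : PrimeIdealr.type {ideal_quot I},
    forall x, (\pi_({ideal_quot I}) x \in P) = (phi x == 0).
Proof.
move=> phiI.
(* Membership is tested on a chosen representative; [SE] shows that the choice is harmless, because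
   [phi] vanishes on $I$. *)
pose S : {pred {ideal_quot I}} := fun q => phi (repr q) == 0.
have SE x : (\pi x \in S) = (phi x == 0).
  rewrite unfold_in /S; suff -> : phi (repr (\pi_({ideal_quot I}) x)) = phi x by [].
  apply/eqP; rewrite -subr_eq0 -rmorphB phiI // Quotient.idealrBE reprK.
  exact: eqxx.
have piD : {morph \pi_({ideal_quot I}) : x y / x + y} by move=> x y; rewrite piE.
have piM : {morph \pi_({ideal_quot I}) : x y / x * y} by move=> x y; rewrite piE.
have Sideal : idealr_closed S.
  split.
  - have -> : 0 = \pi_({ideal_quot I}) 0 by rewrite piE.
    by rewrite SE rmorph0.
  - have -> : 1 = \pi_({ideal_quot I}) 1 by rewrite piE.
    by rewrite SE rmorph1 oner_eq0.
  - move=> a u v; rewrite -[a]reprK -[u]reprK -[v]reprK -piM -piD !SE.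
    by rewrite rmorphD rmorphM => /eqP -> /eqP ->; rewrite mulr0 addr0.
have Sprime : prime_idealr_closed S.
  move=> u v; rewrite -[u]reprK -[v]reprK -piM !SE.
  by rewrite rmorphM mulf_eq0.
pose P : PrimeIdealr.type {ideal_quot I} :=
  HB.pack S (isIdealr.Build _ S Sideal) (isPrimeIdealrClosed.Build _ S Sprime).
by exists P.
Qed.


Variables (K : fieldType) (n : nat).

Lemma generated_memX (I : {pred {mpoly K[n]}}) G m :
  generated_by I G -> 'X_[m] \in I <-> exists2 a, G a & (a <= m)%MM.
Proof.
move=> gG; split=> [mI | [a Ga am]].
  by have : [set` I]%classic 'X_[m]; [exact: mI | rewrite gG => /ideal_span_monomial].
have : [set` I]%classic 'X_[m]; last by [].
rewrite gG -(submK am) mpolyXD; apply: ideal_spanMl; apply: ideal_span_incl.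
by exists a.
Qed.

Lemma mmapX_eq0 (h : 'I_n -> {poly K}) (m : 'X_{1..n}) :
  (mmap polyC h 'X_[m] == 0) = [exists i, (h i == 0) && (m i != 0)%N].
Proof.
rewrite mmapX /mmap1 prodf_seq_eq0; apply/hasP/existsP => [[i _] | [i]] /=.
  by rewrite expf_eq0 lt0n andbC => hi; exists i.
by move=> hi; exists i; rewrite ?mem_index_enum // expf_eq0 lt0n andbC.
Qed.

Lemma dim0_power_mem (I : idealr {mpoly K[n]}) (i : 'I_n) :
  monomial_ideal I -> has_krull_dim {ideal_quot I} 0 ->
  exists k, (0 < k)%N && ('X_i ^+ k \in I).
Proof.
move=> [G gG] [_ dim0]; apply: contrapT => noX.
pose ev (x : {poly K}) : {rmorphism {mpoly K[n]} -> {poly K}} :=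
  mmap polyC (fun j => if j == i then x else 0).
have evI x p : p \in I -> ev x p = 0.
  move=> pI; have : [set` I]%classic p by [].
  rewrite gG => -[s [sG ->]]; rewrite rmorph_sum big_seq big1 // => y /sG [m Gm <-].
  rewrite rmorphM; suff /eqP -> : ev x 'X_[m] == 0 by rewrite mulr0.
  (* A generator not killed by [ev x] involves no variable but $x_i$, so it is a power of $x_i$ in
     $I$. *)
  rewrite mmapX_eq0; apply: contrapT => /negP/existsPn H; apply: noX.
  have mI : 'X_[m] \in I.
    by apply/(generated_memX _ gG); exists m => //; exact: lepm_refl.
  have mE : m = (U_(i) *+ m i)%MM.
    apply/mnmP => j; rewrite mulmnE mnm1E; case: eqVneq => [-> | ij]; first by rewrite mul1n.
    by have := H j; rewrite ifN_eqC // eqxx /= negbK => /eqP.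
  exists (m i); rewrite mpolyXn -mE mI andbT lt0n; apply/eqP => m0.
  (* A zero exponent would put $1$ in $I$, but an [idealr] is proper. *)
  by move: mI; rewrite mE m0 mulm0n mpolyX0 idealr1.
have [P0 P0E] := prime_ideal_quot_kernel (evI 'X).
have [P1 P1E] := prime_ideal_quot_kernel (evI 0).
suff /dim0 : prime_chain {ideal_quot I} 1 by [].
exists (fun k => if k == ord0 then P0 else P1) => j k jk.
have [-> ->] : j = ord0 /\ k = ord_max.
  by case: j k jk => [[|[|]] // ?] [[|[|]] // ?] _; split; apply: val_inj.
rewrite eqxx /=; split=> [q | /(_ (\pi 'X_i))].
  rewrite -[q]reprK P0E P1E.
  (* Evaluation at $0$ is evaluation at $x$ followed by $x\mapsto 0$, so one kernel contains the
     other; $x_i$ itself shows that the inclusion is strict. *)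
  have -> : ev 0 (repr q) = ev 'X (repr q) \Po 0.
    rewrite /ev /= /mmap rmorph_sum; apply: eq_bigr => m _ /=.
    rewrite rmorphM /= comp_polyC rmorph_prod; congr (_ * _); apply: eq_bigr => l _ /=.
    by rewrite rmorphXn /=; case: ifP; rewrite ?comp_polyX ?comp_poly0.
  by move=> /eqP ->; rewrite comp_poly0.
rewrite P0E P1E /ev /= !mmapX !mmap1U eqxx eqxx polyX_eq0 => /(_ isT).
by [].
Qed.

End ZeroDimensional.

(** * Faces and facets of $\Delta(I)$ *)

Section Facets.
Variables (K : fieldType) (n : nat) (I : {pred {mpoly K[n]}}).
Hypothesis monI : monomial_ideal I.
Hypothesis powI : forall i : 'I_n, exists k, (0 < k)%N && ('X_i ^+ k \in I)%R.

Implicit Types (F : {set polvar I}) (a v : 'X_{1..n}).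

Lemma memX_mingens a : ('X_[a] \in I)%R <-> exists2 v, mingens I v & (v <= a)%MM.
Proof. by apply: generated_memX; have [[]] := mingensP monI. Qed.

Lemma var_expP i : (0 < var_exp I i)%N /\ ('X_i ^+ var_exp I i \in I)%R.
Proof.
rewrite /var_exp; case: pselect => [h | /(_ (powI i)) []].
by case: ex_minnP => k /andP[].
Qed.

(** Thanks to this bound $x_{i,a_i}$ is a variable of the polarization, as [standard_var]
    requires. *)
Lemma standard_lt_var_exp a i : ('X_[a] \notin I)%R -> (a i < var_exp I i)%N.
Proof.
have [_ bI] := var_expP i; rewrite mpolyXn in bI.
apply: contraR; rewrite -leqNgt => bai; have [v vI /mnm_lepP vb] := (memX_mingens _).1 bI.
apply/memX_mingens; exists v => //; apply/mnm_lepP => j; apply: leq_trans (vb j) _.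
by rewrite mulmnE mnm1E; case: eqP => [<- | _]; rewrite ?mul1n ?mul0n.
Qed.

Definition polsupp v : {set polvar I} := [set t : polvar I | tagged t < v (tag t)]%SET.

Definition expset F : 'X_{1..#|polvar I|} := (\sum_(t in F) U_(enum_rank t))%MM.

Lemma expsetE F t : expset F (enum_rank t) = (t \in F).
Proof.
rewrite /expset mnm_sumE big_mkcond (bigD1 t) //= big1 => [| u ut].
  by rewrite mnm1E eqxx; case: ifP.
by rewrite mnm1E (inj_eq enum_rank_inj) (negPf ut) if_same.
Qed.

Lemma prod_mvar F : (\prod_(t in F) mvar K t = 'X_[expset F])%R.
Proof. by rewrite (big_morph _ (@mpolyXD _ _) (@mpolyX0 _ _)). Qed.

Lemma expset_le F G : (expset F <= expset G)%MM = (F \subset G).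
Proof.
apply/mnm_lepP/subsetP => [FG t tF | FG i].
  by have := FG (enum_rank t); rewrite !expsetE tF; case: (t \in G).
by rewrite -(enum_valK i) !expsetE; have := FG (enum_val i); case: (_ \in F) => // ->.
Qed.

Lemma polmonE v : polmon I v = 'X_[expset (polsupp v)]%R.
Proof. by rewrite -prod_mvar; apply: eq_bigl => t; rewrite inE. Qed.

(** A monomial lies in a monomial ideal iff some generator divides it, and divisibility of
    squarefree monomials is inclusion of supports. *)
Lemma mem_Delta F :
  (F \in faces (Delta I)) <-> forall v, mingens I v -> ~~ (polsupp v \subset F).
Proof.
rewrite inE prod_mvar; split=> [/asboolP nF v vI | nF].
  apply/negP; rewrite -expset_le => vF; apply: nF.
  rewrite -(submK vF) mpolyXD; apply: ideal_spanMl; apply: ideal_span_incl.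
  by exists v => //; rewrite polmonE.
apply/asboolP => FI.
have : ideal_span [set 'X_[K, d] | d in [set expset (polsupp v) | v in mingens I]]%classic
    'X_[expset F]%R.
  apply: ideal_span_idem FI => _ [v vI <-]; apply: ideal_span_incl.
  by exists (expset (polsupp v)); [exists v | rewrite polmonE].
move=> /ideal_span_monomial[_ [v vI <-]]; rewrite expset_le => vF.
by move: (nF v vI); rewrite vF.
Qed.

(** Phrasing this by inequality of indices makes sense for every [a]; if $x^a\notin I$, exactly one
    variable per $i$ is left out ([setC_cofacet]). *)
Definition cofacet a : {set polvar I} :=
  [set t : polvar I | val (tagged t) != a (tag t)]%SET.

Lemma polvar_eq (t u : polvar I) :
  tag t = tag u -> val (tagged t) = val (tagged u) -> t = u.
Proof. by case: t u => [i j] [k l] /= ik; case: _ / ik l => l /val_inj ->. Qed.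

Definition standard_var a (aI : ('X_[a] \notin I)%R) (i : 'I_n) : polvar I :=
  Tagged (fun i => 'I_(var_exp I i)) (Ordinal (standard_lt_var_exp i aI)).

Lemma standard_var_inj a (aI : ('X_[a] \notin I)%R) : injective (standard_var aI).
Proof. by move=> i j /(congr1 (@tag _ _)). Qed.

Lemma setC_cofacet a (aI : ('X_[a] \notin I)%R) :
  (~: cofacet a = [set standard_var aI i | i : 'I_n])%SET.
Proof.
apply/setP => t; rewrite !inE negbK; apply/eqP/imsetP => [ta | [i _ ->] //].
by exists (tag t) => //; apply: polvar_eq.
Qed.

(** The size does not depend on [a]: this gives purity and, in [facetE], maximality of the
    cofacets. *)
Lemma card_cofacet a : ('X_[a] \notin I)%R -> #|cofacet a| = #|polvar I| - n.
Proof.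
move=> aI; rewrite -(cardsC (cofacet a)) (setC_cofacet aI) card_imset; last first.
  exact: standard_var_inj.
by rewrite card_ord addnK.
Qed.

(** A generator $v$ whose polarized support lay in the cofacet would avoid each $x_{i,a_i}$, so
    $v\le a$ and $x^a\in I$. *)
Lemma cofacet_face a : ('X_[a] \notin I)%R -> cofacet a \in faces (Delta I).
Proof.
move=> aI; apply/mem_Delta => v vI; apply/negP => /subsetP va.
move/negP: (aI); apply; apply/memX_mingens; exists v => //; apply/mnm_lepP => i.
rewrite leqNgt; apply/negP => ai.
by have := va (standard_var aI i); rewrite !inE /= eqxx => /(_ ai).
Qed.

Lemma face_sub_cofacet F :
  F \in faces (Delta I) -> exists2 a, ('X_[a] \notin I)%R & F \subset cofacet a.
Proof.
move=> /mem_Delta nF.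
have ex_missing i : exists k, [exists t : polvar I,
    [&& tag t == i, val (tagged t) == k & t \notin F]].
  (* If no $x_{i,j}$ were missing from $F$, a generator dividing $x_i^{b_i}$ would have its
     polarized support inside $F$. *)
  apply: contrapT => H; have [_] := var_expP i; rewrite mpolyXn.
  case/memX_mingens => v /nF/negP vF /mnm_lepP vb; apply: vF.
  apply/subsetP => t; rewrite inE => tv; apply: contraPT H => tF; apply.
  exists (val (tagged t)); apply/existsP; exists t; rewrite eqxx tF !andbT.
  have := leq_trans tv (vb _); rewrite mulmnE mnm1E eq_sym.
  by case: eqP; rewrite ?mul0n.
pose a := [multinom ex_minn (ex_missing i) | i < n].
have a_min t : t \notin F -> (a (tag t) <= tagged t)%N.
  move=> tF; rewrite mnmE; case: ex_minnP => k _; apply.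
  by apply/existsP; exists t; rewrite !eqxx.
have a_miss i : exists t : polvar I, [/\ tag t = i, val (tagged t) = a i & t \notin F].
  rewrite mnmE; case: ex_minnP => k /existsP[t /and3P[/eqP ti /eqP tk tF]] _.
  by exists t.
exists a.
  (* If a generator $v$ divided $x^a$, each $x_{i,j}$ with $j<v_i\le a_i$ would lie in $F$ by
     minimality of $a_i$. *)
  apply/negP => /memX_mingens[v /nF/negP vF /mnm_lepP va]; apply: vF.
  apply/subsetP => t; rewrite inE => tv; apply: contraTT tv => /a_min at_.
  by rewrite -leqNgt (leq_trans (va _)).
apply/subsetP => t tF; rewrite inE; apply/eqP => ta.
have [u [ut ua /negP[]]] := a_miss (tag t).
by rewrite (@polvar_eq u t) // ua.
Qed.

Lemma facetE F :
  facet (Delta I) F <-> exists2 a, ('X_[a] \notin I)%R & F = cofacet a.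
Proof.
split=> [/maxsetP[/face_sub_cofacet[a aI Fa] Fmax] | [a aI ->]].
  by exists a => //; apply/esym/Fmax => //; exact: cofacet_face.
apply/maxsetP; split=> [|G /face_sub_cofacet[b bI Gb] aG]; first exact: cofacet_face.
have ab : cofacet a = cofacet b.
  by apply/eqP; rewrite eqEcard !card_cofacet // leqnn andbT (fintype.subset_trans aG).
by apply/eqP; rewrite eqEsubset aG andbT ab.
Qed.

(** * The shelling order *)

Definition codegree F : nat := \sum_(t in ~: F) tagged t.

Lemma codegree_cofacet a : ('X_[a] \notin I)%R -> codegree (cofacet a) = mdeg a.
Proof.
move=> aI; rewrite /codegree (setC_cofacet aI) big_imset /=; last first.
  by move=> i j _ _; exact: standard_var_inj.
by rewrite mdegE; apply: eq_bigl => i; rewrite inE.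
Qed.

Lemma standard_lem a b : (a <= b)%MM -> ('X_[b] \notin I)%R -> ('X_[a] \notin I)%R.
Proof.
move=> ab; apply: contra => /memX_mingens[v vI va]; apply/memX_mingens.
by exists v => //; exact: lepm_trans ab.
Qed.

(** Otherwise $b\le a$, and the degrees force $a-b=0$. *)
Lemma mdeg_lt_witness a b :
  a != b -> (mdeg a <= mdeg b)%N -> exists i, (a i < b i)%N.
Proof.
move=> ab dab; apply/existsP; apply: contraNT ab => /existsPn ba.
have {}ba : (b <= a)%MM by apply/mnm_lepP => i; have := ba i; rewrite -leqNgt.
move: dab; rewrite -(submK ba) mdegD -[X in (_ <= X)%N]add0n leq_add2r leqn0 mdeg_eq0.
by move=> /eqP ->; rewrite add0m.
Qed.

Lemma Delta_shellable : shellable (Delta I).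
Proof.
split=> [F G /facetE[a aI ->] /facetE[b bI ->] | ].
  by rewrite !card_cofacet.
(* [codegree] recovers the degree of $x^a$ from the facet alone. Ties may be broken in any order,
   since the earlier facet used below has strictly smaller degree. *)
pose s := sort (relpre codegree leq) (enum (facet (Delta I))).
have mem_s : s =i facet (Delta I) by move=> F; rewrite mem_sort mem_enum.
have uniq_s : uniq s by rewrite sort_uniq enum_uniq.
have codegree_mono i j : (i <= j < size s)%N ->
    (codegree (nth finset.set0 s i) <= codegree (nth finset.set0 s j))%N.
  move=> /andP[ij js]; apply: (@sorted_leq_nth _ (relpre codegree leq)) => //.
  - by move=> ? ? ? /=; exact: leq_trans.
  - by move=> ? /=.
  - by apply: sort_sorted => ? ? /=; exact: leq_total.
  - by rewrite inE (leq_ltn_trans ij).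
exists s; split=> // i j /andP[ij js] F.
have Fstd k : (k < size s)%N -> exists2 a, ('X_[a] \notin I)%R & F k = cofacet a.
  by move=> ks; apply/facetE; have := mem_nth finset.set0 ks; rewrite mem_s.
have [a aI Fi] := Fstd i (ltn_trans ij js); have [b bI Fj] := Fstd j js.
have [t abt] : exists t, (a t < b t)%N.
  apply: mdeg_lt_witness; last first.
    by rewrite -!codegree_cofacet // -Fi -Fj codegree_mono // ltnW.
  apply/eqP => ab; have : F i == F j by rewrite Fi Fj ab.
  by rewrite nth_uniq ?(ltn_trans ij) // ltn_eqF.
pose c := [multinom if l == t then a t else b l | l < n].
have cb : (c <= b)%MM.
  by apply/mnm_lepP => l; rewrite mnmE; case: eqP => // ->; exact: ltnW.
have cI := standard_lem cb bI.
have cs : cofacet c \in s by rewrite mem_s; apply/facetE; exists c.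
exists (standard_var aI t); rewrite Fi Fj; split.
  by rewrite !inE /= eqxx ltn_eqF.
exists (index (cofacet c) s).
  (* If the facet of $c$ did not precede [F j], sorting would give $\deg b\le\deg c$; as $c\ne b$,
     some $c_l>b_l$, against $c\le b$. *)
  rewrite ltnNge; apply/negP => jc.
  have := codegree_mono _ _ (introT andP (conj jc (etrans (index_mem _ _) cs))).
  rewrite nth_index // -/(F j) Fj !codegree_cofacet // => /mdeg_lt_witness[|l].
    by apply/eqP => /mnmP/(_ t); rewrite mnmE eqxx => ba; rewrite ba ltnn in abt.
  by rewrite ltnNge (mnm_lepP cb).
(* $b$ and $c$ differ only at $t$, so the only variable of [F j] missing from the facet of $c$ is
   $x_{t,a_t}$. *)
rewrite /F nth_index //; apply/setP => u; rewrite !inE negbK mnmE.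
apply/andP/eqP => [[/eqP uc ub] | ->]; last by rewrite /= !eqxx ltn_eqF.
move: uc; case: eqP => [ut | _] uc; last by rewrite uc eqxx in ub.
exact: polvar_eq.
Qed.

End Facets.

Theorem corollary2p3 (K : fieldType) (n : nat) (I : idealr {mpoly K[n]})
    (monI : monomial_ideal I) (dimI : has_krull_dim {ideal_quot I} 0) :
  shellable (Delta I).
Proof.
apply: Delta_shellable => // i.
exact: dim0_power_mem.
Qed.
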